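(* Let $A$ be a semisimple MV-algebra, and let $\mathbf{R}(A)$ be the Riesz MV-algebra generated by (the image of) $A$ in the Dedekind-MacNeille completion $\widehat{A_d}$ of the divisible hull $A_d$ of $A$, and let $\iota_A:A\to\mathbf{R}(A)$ be the canonical map (both described in the context). Then the following hold. (a) $\iota_A:A\to \mathbf{R}(A)$ is an MV-embedding and $\mathbf{R}(A)=\langle\iota_A(A)\rangle_{RMV}$. (b) The embedding $\iota_A$ is essential. (c) If $V$ is a semisimple Riesz MV-algebra and $f:A\to V$ is an MV-embedding, then there exists an MV-embedding $f_R:\mathbf{R}(A)\to V$ such that $f_R(\iota_A(a))=f(a)$ for any $a\in A$.
   Context: An MV-algebra is a structure $(A,\oplus,{}^*,0)$ such that $(A,\oplus,0)$ is an abelian monoid, $(a^* )^*=a$, $0^*\oplus a=0^*$ and $(a^*\oplus b)^*\oplus b=(b^*\oplus a)^*\oplus a$. Put $1=0^*$, $a\odot b=(a^*\oplus b^* )^*$; $a\le b$ iff $a\odot b^*=0$ (a bounded distributive lattice order). For $n\in\mathbb N$, $na=a\oplus\cdots\oplus a$ ($n$ times), $0a=0$. An ideal is a nonempty downward closed subset closed under $\oplus$; $A$ is semisimple if the intersection of its maximal (proper) ideals is $\{0\}$. MV-homomorphisms preserve $\oplus,{}^*,0$; an MV-embedding is an injective MV-homomorphism. An embedding $\iota:A\to B$ is essential if for every $b>0$ in $B$ there are $a>0$ in $A$ and $n\in\mathbb N$ with $\iota(a)\le nb$. A Riesz MV-algebra is an MV-algebra $V$ with a map $\cdot:[0,1]\times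 V\to V$ such that $r(a\odot b^* )=(ra)\odot(rb)^*$, $\max(r-q,0)\,a=(ra)\odot(qa)^*$, $(rq)a=r(qa)$, $1a=a$ for all $r,q\in[0,1]$, $a,b\in V$. It is called semisimple if its MV-algebra reduct is. MV-homomorphisms between Riesz MV-algebras automatically preserve scalar multiplication. For a subset $X$ of a Riesz MV-algebra, $\langle X\rangle_{RMV}$ is the Riesz MV-subalgebra generated by $X$. Construction of $\mathbf R(A)$. For an abelian lattice-ordered group $G$ with strong unit $u$, $\Gamma(G,u)$ is the MV-algebra $[0,u]$ with $x\oplus y=(x+y)\wedge u$, $x^*=u-x$; every MV-algebra is of this form up to isomorphism. If $A=\Gamma(G,u)$, its divisible hull is $A_d=\Gamma(G_d,u)$, where $G_d=\{g/n\mid g\in G,\ n\ge1\}$ is the divisible hull of $G$. For $A$ semisimple, $A_d$ is semisimple. The Dedekind-MacNeille completion $\hat B$ of a semisimple MV-algebra $B$ is the (unique up to isomorphism) MV-algebra containing $B$ as a subalgebra, complete as a lattice, in which every element is a supremum of elements of $B$. The completion $\widehat{A_d}$ carries a (unique) Riesz MV-algebra structure. $\mathbf R(A)$ is the Riesz MV-subalgebra of $\widehat{A_d}$ generated by the image of $A$ under the composite of the canonical embeddings $A\to A_d\to\widehat{A_d}$, and $\iota_A:A\to\mathbf R(A)$ is this composite with codomain restricted to $\mathbf R(A)$. *)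

(* Defs.v *)
From HB Require Import structures.
From mathcomp Require Import all_boot all_order all_algebra.
From mathcomp Require Import interval_inference.
From mathcomp Require Import all_classical all_reals.

Set Implicit Arguments.
Unset Strict Implicit.
Unset Printing Implicit Defensive.

Import Order.TTheory GRing.Theory Num.Theory.

Local Open Scope classical_set_scope.
Local Open Scope ring_scope.

Declare Scope mv_scope.
Delimit Scope mv_scope with MV.
Local Open Scope mv_scope.

Reserved Notation "x ⊕ y" (at level 50, left associativity).
Reserved Notation "x ⊙ y" (at level 40, left associativity).

(** * MV-algebras *)

HB.mixin Record isMVAlgebra (A : Type) := {
  mvplus : A -> A -> A;
  mvneg : A -> A;
  mv0 : A;
  mvplusA : associative mvplus;
  mvplusC : commutative mvplus;
  mvplus0 : right_id mv0 mvplus;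
  mvnegK : involutive mvneg;
  mvplus1 : forall a, mvplus (mvneg mv0) a = mvneg mv0;
  mvplus_join : forall a b,
    mvplus (mvneg (mvplus (mvneg a) b)) b =
    mvplus (mvneg (mvplus (mvneg b) a)) a
}.

#[short(type="mvAlgType")]
HB.structure Definition MVAlgebra := {A of isMVAlgebra A}.

Notation "x ⊕ y" := (mvplus x y) : mv_scope.

Definition mvtimes (A : mvAlgType) (a b : A) : A :=
  mvneg (mvneg a ⊕ mvneg b).

Notation "x ⊙ y" := (mvtimes x y) : mv_scope.

Definition mvle (A : mvAlgType) (a b : A) : Prop := a ⊙ mvneg b = mv0.

Definition mvlt (A : mvAlgType) (a b : A) : Prop := mvle a b /\ a <> b.

Definition mvmuln (A : mvAlgType) (n : nat) (a : A) : A :=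
  iter n (mvplus a) mv0.

Definition mv_ideal (A : mvAlgType) (I : set A) : Prop :=
  [/\ I !=set0,
      forall a b, mvle a b -> I b -> I a &
      forall a b, I a -> I b -> I (a ⊕ b)].

Definition mv_maximal_ideal (A : mvAlgType) (I : set A) : Prop :=
  [/\ mv_ideal I, I <> setT &
      forall J : set A, mv_ideal J -> J <> setT -> I `<=` J -> J = I].

(* The trivial algebra has no maximal ideal; the empty intersection is then
   the whole algebra, so that it counts as semisimple. *)
Definition semisimple (A : mvAlgType) : Prop :=
  \bigcap_(I in [set I : set A | mv_maximal_ideal I]) I = [set mv0].

Definition mv_hom (A B : mvAlgType) (f : A -> B) : Prop :=
  [/\ forall a b, f (a ⊕ b) = f a ⊕ f b,
      forall a, f (mvneg a) = mvneg (f a) &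
      f mv0 = mv0].

Definition mv_embedding (A B : mvAlgType) (f : A -> B) : Prop :=
  mv_hom f /\ injective f.

Definition mv_isomorphism (A B : mvAlgType) (f : A -> B) : Prop :=
  mv_hom f /\ bijective f.

Definition essential (A B : mvAlgType) (f : A -> B) : Prop :=
  forall b : B, mvlt mv0 b ->
    exists (a : A) (n : nat), mvlt mv0 a /\ mvle (f a) (mvmuln n b).

(** * Riesz MV-algebras *)

HB.mixin Record MVAlgebra_isRiesz (R : realType) V of isMVAlgebra V := {
  rscale : {i01 R} -> V -> V;
  rscale_minus : forall (r : {i01 R}) (a b : V),
    rscale r (a ⊙ mvneg b) = rscale r a ⊙ mvneg (rscale r b);
  rscale_max : forall (r q : {i01 R}) (a : V),
    rscale (Num.max (r%:num - q%:num) 0)%:i01 a =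
    rscale r a ⊙ mvneg (rscale q a);
  rscaleA : forall (r q : {i01 R}) (a : V),
    rscale (r%:num * q%:num)%:i01 a = rscale r (rscale q a);
  rscale1 : forall a : V, rscale 1%:i01 a = a
}.

#[short(type="rieszMVType")]
HB.structure Definition RieszMV (R : realType) :=
  {V of isMVAlgebra V & MVAlgebra_isRiesz R V}.

Definition rmv_subalgebra (R : realType) (V : rieszMVType R) (S : set V) :
    Prop :=
  [/\ S mv0,
      forall a b, S a -> S b -> S (a ⊕ b),
      forall a, S a -> S (mvneg a) &
      forall (r : {i01 R}) a, S a -> S (rscale r a)].

Definition rmv_span (R : realType) (V : rieszMVType R) (X : set V) : set V :=
  smallest (@rmv_subalgebra R V) X.

(* [rmv_span X] as a Riesz MV-algebra in its own right. *)
Definition rmv_gen (R : realType) (V : rieszMVType R) (X : set V) : Type :=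
  set_type (rmv_span X).

Section RmvGen.
Context {R : realType} {V : rieszMVType R} (X : set V).

Lemma rmv_span_subalgebra : rmv_subalgebra (rmv_span X).
Proof.
split.
- by move=> S [[]].
- by move=> a b Ha Hb S HS; case: (HS) => -[_ HD _ _] _; apply: HD;
    [exact: Ha | exact: Hb].
- by move=> a Ha S HS; case: (HS) => -[_ _ HN _] _; apply: HN; exact: Ha.
- by move=> r a Ha S HS; case: (HS) => -[_ _ _ HZ] _; apply: HZ; exact: Ha.
Qed.

Definition to_gen (x : V) (h : rmv_span X x) : rmv_gen X := SigSub (mem_set h).

Definition of_gen (x : rmv_gen X) : V := val x.

Lemma of_genP (x : rmv_gen X) : rmv_span X (of_gen x).
Proof. exact: set_mem (valP x). Qed.

Lemma of_gen_inj : injective of_gen.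
Proof. exact: val_inj. Qed.

Definition gen_plus (x y : rmv_gen X) : rmv_gen X :=
  let: And4 _ HD _ _ := rmv_span_subalgebra in
  to_gen (HD _ _ (of_genP x) (of_genP y)).

Definition gen_neg (x : rmv_gen X) : rmv_gen X :=
  let: And4 _ _ HN _ := rmv_span_subalgebra in to_gen (HN _ (of_genP x)).

Definition gen_0 : rmv_gen X :=
  let: And4 H0 _ _ _ := rmv_span_subalgebra in to_gen H0.

Definition gen_scale (r : {i01 R}) (x : rmv_gen X) : rmv_gen X :=
  let: And4 _ _ _ HZ := rmv_span_subalgebra in to_gen (HZ r _ (of_genP x)).

Lemma of_gen_plus x y : of_gen (gen_plus x y) = of_gen x ⊕ of_gen y.
Proof. by rewrite /gen_plus; case: rmv_span_subalgebra. Qed.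

Lemma of_gen_neg x : of_gen (gen_neg x) = mvneg (of_gen x).
Proof. by rewrite /gen_neg; case: rmv_span_subalgebra. Qed.

Lemma of_gen_0 : of_gen gen_0 = mv0.
Proof. by rewrite /gen_0; case: rmv_span_subalgebra. Qed.

Lemma of_gen_scale r x : of_gen (gen_scale r x) = rscale r (of_gen x).
Proof. by rewrite /gen_scale; case: rmv_span_subalgebra. Qed.

Let ofE := (of_gen_plus, of_gen_neg, of_gen_0, of_gen_scale).

Fact gen_plusA : associative gen_plus.
Proof. by move=> x y z; apply: of_gen_inj; rewrite !ofE mvplusA. Qed.

Fact gen_plusC : commutative gen_plus.
Proof. by move=> x y; apply: of_gen_inj; rewrite !ofE mvplusC. Qed.

Fact gen_plus0 : right_id gen_0 gen_plus.
Proof. by move=> x; apply: of_gen_inj; rewrite !ofE mvplus0. Qed.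

Fact gen_negK : involutive gen_neg.
Proof. by move=> x; apply: of_gen_inj; rewrite !ofE mvnegK. Qed.

Fact gen_plus1 x : gen_plus (gen_neg gen_0) x = gen_neg gen_0.
Proof. by apply: of_gen_inj; rewrite !ofE mvplus1. Qed.

Fact gen_plus_join x y :
  gen_plus (gen_neg (gen_plus (gen_neg x) y)) y =
  gen_plus (gen_neg (gen_plus (gen_neg y) x)) x.
Proof. by apply: of_gen_inj; rewrite !ofE mvplus_join. Qed.

HB.instance Definition _ := isMVAlgebra.Build (rmv_gen X)
  gen_plusA gen_plusC gen_plus0 gen_negK gen_plus1 gen_plus_join.

Lemma of_gen_minus (x y : rmv_gen X) :
  of_gen (x ⊙ mvneg y) = of_gen x ⊙ mvneg (of_gen y).
Proof. by rewrite /mvtimes !ofE. Qed.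

Fact gen_scale_minus (r : {i01 R}) (x y : rmv_gen X) :
  gen_scale r (x ⊙ mvneg y) = gen_scale r x ⊙ mvneg (gen_scale r y).
Proof.
by apply: of_gen_inj; rewrite of_gen_scale !of_gen_minus rscale_minus !ofE.
Qed.

Fact gen_scale_max (r q : {i01 R}) (x : rmv_gen X) :
  gen_scale (Num.max (r%:num - q%:num) 0)%:i01 x =
  gen_scale r x ⊙ mvneg (gen_scale q x).
Proof. by apply: of_gen_inj; rewrite of_gen_minus !ofE rscale_max. Qed.

Fact gen_scaleA (r q : {i01 R}) (x : rmv_gen X) :
  gen_scale (r%:num * q%:num)%:i01 x = gen_scale r (gen_scale q x).
Proof. by apply: of_gen_inj; rewrite !ofE rscaleA. Qed.

Fact gen_scale1 (x : rmv_gen X) : gen_scale 1%:i01 x = x.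
Proof. by apply: of_gen_inj; rewrite !ofE rscale1. Qed.

HB.instance Definition _ := MVAlgebra_isRiesz.Build R (rmv_gen X)
  gen_scale_minus gen_scale_max gen_scaleA gen_scale1.

End RmvGen.

(** * Abelian lattice-ordered groups and the functor Γ *)

(* A translation-invariant partial order with binary meets and joins.  The
   lattice structures of [order.v] are not reused because Hierarchy Builder
   requires their joins with the additive structures to be declared before
   [realDomainType]. *)
HB.mixin Record POrderedZmodule_isLGroup G of Num.POrderedZmodule G := {
  lgmeet : G -> G -> G;
  lgjoin : G -> G -> G;
  lg_le_meet : forall x y z : G, (z <= lgmeet x y) = (z <= x) && (z <= y);
  lg_join_le : forall x y z : G, (lgjoin x y <= z) = (x <= z) && (y <= z);
  lgD2r : forall x y z : G, x <= y -> x + z <= y + z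
}.

#[short(type="lgroupType")]
HB.structure Definition LGroup :=
  {G of Num.POrderedZmodule G & POrderedZmodule_isLGroup G}.

Section LGroupTheory.
Context {G : lgroupType}.
Implicit Types x y z : G.

Lemma lg_meetl x y : lgmeet x y <= x.
Proof. by have := lexx (lgmeet x y); rewrite lg_le_meet => /andP[]. Qed.

Lemma lg_meetr x y : lgmeet x y <= y.
Proof. by have := lexx (lgmeet x y); rewrite lg_le_meet => /andP[]. Qed.

Lemma lg_joinl x y : x <= lgjoin x y.
Proof. by have := lexx (lgjoin x y); rewrite lg_join_le => /andP[]. Qed.

Lemma lg_joinr x y : y <= lgjoin x y.
Proof. by have := lexx (lgjoin x y); rewrite lg_join_le => /andP[]. Qed.

Lemma lg_meet_idPl x y : reflect (lgmeet x y = x) (x <= y).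
Proof.
apply: (iffP idP) => [xy|<-]; last exact: lg_meetr.
by apply/eqP; rewrite eq_le lg_meetl lg_le_meet lexx.
Qed.

Lemma lg_meetC x y : lgmeet x y = lgmeet y x.
Proof. by apply/eqP; rewrite eq_le !lg_le_meet !lg_meetl !lg_meetr. Qed.

Lemma lg_joinC x y : lgjoin x y = lgjoin y x.
Proof. by apply/eqP; rewrite eq_le !lg_join_le !lg_joinl !lg_joinr. Qed.

Lemma lg_meetA x y z : lgmeet x (lgmeet y z) = lgmeet (lgmeet x y) z.
Proof.
have E t : (t <= lgmeet x (lgmeet y z)) = (t <= lgmeet (lgmeet x y) z).
  by rewrite !lg_le_meet andbA.
by apply/eqP; rewrite eq_le -E lexx E lexx.
Qed.

Lemma lgD2rE x y z : (x + z <= y + z) = (x <= y).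
Proof.
apply/idP/idP => [/(lgD2r _ _ (- z))|]; first by rewrite !addrK.
exact: lgD2r.
Qed.

Lemma lgB_le x y z : (x - y <= z) = (x <= z + y).
Proof. by rewrite -(lgD2rE (x - y) z y) subrK. Qed.

Lemma lg_leB x y z : (x <= y - z) = (x + z <= y).
Proof. by rewrite -(lgD2rE x (y - z) z) subrK. Qed.

Lemma lgN2 x y : (- x <= - y) = (y <= x).
Proof. by rewrite -[- y]add0r lg_leB addrC lgB_le add0r. Qed.

Lemma lgD x y z t : x <= y -> z <= t -> x + z <= y + t.
Proof.
move=> xy zt; apply: (@le_trans _ _ (y + z)); first exact: lgD2r.
by rewrite ![y + _]addrC; exact: lgD2r.
Qed.

Lemma lg_meetDr x y z :
  lgmeet x y + z = lgmeet (x + z) (y + z).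
Proof.
apply/eqP; rewrite eq_le lg_le_meet !lgD2rE lg_meetl lg_meetr /=.
by rewrite -lgB_le lg_le_meet !lgB_le lg_meetl lg_meetr.
Qed.

Lemma lg_joinDr x y z :
  lgjoin x y + z = lgjoin (x + z) (y + z).
Proof.
apply/eqP; rewrite eq_le lg_join_le !lgD2rE lg_joinl lg_joinr andbT.
by rewrite -lg_leB lg_join_le !lg_leB lg_joinl lg_joinr.
Qed.

Lemma lgNl x y : (- x <= y) = (- y <= x).
Proof. by rewrite -[y in LHS]opprK lgN2. Qed.

Lemma lg_opp_meet x y : - lgmeet x y = lgjoin (- x) (- y).
Proof.
apply/eqP; rewrite eq_le lg_join_le !lgN2 lg_meetl lg_meetr andbT.
by rewrite lgNl lg_le_meet ![- lgjoin _ _ <= _]lgNl lg_joinl lg_joinr.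
Qed.

Lemma lg_mulrn_ge0 x n : 0 <= x -> 0 <= x *+ n.
Proof.
by move=> x0; elim: n => [|n IHn]; rewrite ?mulr0n// mulrS -[leLHS]addr0 lgD.
Qed.

Lemma lg_le_mulrn x n : 0 <= x -> (0 < n)%N -> x <= x *+ n.
Proof.
move=> x0; case: n => // n _.
by rewrite mulrS -[leLHS]addr0 lgD// lg_mulrn_ge0.
Qed.

End LGroupTheory.

Record strong_unit (G : lgroupType) := StrongUnit {
  su_val : G;
  su_ge0 : 0 <= su_val;
  su_dom : forall x : G, exists n : nat, x <= su_val *+ n
}.

Definition Gamma (G : lgroupType) (u : strong_unit G) : Type :=
  {x : G | (0 <= x) && (x <= su_val u)}.

Section GammaMV.
Context {G : lgroupType} (u : strong_unit G).
Implicit Types x y z : Gamma u.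

Fact Gamma_plus_subproof x y :
  (0 <= lgmeet (val x + val y) (su_val u)) &&
  (lgmeet (val x + val y) (su_val u) <= su_val u).
Proof.
case: x y => [x /= /andP[x0 _]] [y /= /andP[y0 _]].
by rewrite lg_meetr andbT lg_le_meet su_ge0 andbT -[leLHS]addr0 lgD.
Qed.

Definition Gamma_plus x y : Gamma u :=
  exist _ (lgmeet (val x + val y) (su_val u)) (Gamma_plus_subproof x y).

Fact Gamma_neg_subproof x : (0 <= su_val u - val x) && (su_val u - val x <= su_val u).
Proof.
case: x => [x /= /andP[x0 xu]].
by rewrite lg_leB add0r xu lgB_le -[leLHS]addr0 lgD.
Qed.

Definition Gamma_neg x : Gamma u :=
  exist _ (su_val u - val x) (Gamma_neg_subproof x).

Fact Gamma_0_subproof : ((0 : G) <= 0) && ((0 : G) <= su_val u).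
Proof. by rewrite lexx su_ge0. Qed.

Definition Gamma_0 : Gamma u := exist _ 0 Gamma_0_subproof.

Let val_ge0 x : 0 <= val x.
Proof. by case: x => x /= /andP[]. Qed.

Let val_leu x : val x <= su_val u.
Proof. by case: x => x /= /andP[]. Qed.

Let meetDu (a : G) z :
  lgmeet (lgmeet a (su_val u) + val z) (su_val u) =
  lgmeet (a + val z) (su_val u).
Proof.
rewrite lg_meetDr -lg_meetA; congr lgmeet.
by rewrite lg_meetC; apply/lg_meet_idPl; rewrite -[leLHS]addr0 lgD.
Qed.

Fact Gamma_plusC : commutative Gamma_plus.
Proof. by move=> x y; apply: val_inj; rewrite /= addrC. Qed.

Fact Gamma_plusA : associative Gamma_plus.
Proof.
move=> x y z; apply: val_inj => /=.
by rewrite meetDu [val x + _]addrC meetDu addrC addrA.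
Qed.

Fact Gamma_plus0 : right_id Gamma_0 Gamma_plus.
Proof.
move=> x; apply: val_inj; rewrite /= addr0.
by apply/lg_meet_idPl; exact: (val_leu x).
Qed.

Fact Gamma_negK : involutive Gamma_neg.
Proof. by move=> x; apply: val_inj; rewrite /= subKr. Qed.

Fact Gamma_plus1 x : Gamma_plus (Gamma_neg Gamma_0) x = Gamma_neg Gamma_0.
Proof.
apply: val_inj; rewrite /= subr0 lg_meetC; apply/lg_meet_idPl.
by rewrite -[leLHS]addr0; exact: (lgD (lexx _) (val_ge0 x)).
Qed.

Let joinE x y :
  val (Gamma_plus (Gamma_neg (Gamma_plus (Gamma_neg x) y)) y) =
  lgjoin (val x) (val y).
Proof.
rewrite /= lg_opp_meet [_ + lgjoin _ _]addrC lg_joinDr addNr.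
have -> : - (su_val u - sval x + sval y) + su_val u = sval x - sval y.
  by rewrite !opprD opprK addrC !addrA subrr add0r.
rewrite lg_joinDr subrK add0r; apply/lg_meet_idPl; rewrite lg_join_le.
by apply/andP; split; exact: val_leu.
Qed.

Fact Gamma_plus_join x y :
  Gamma_plus (Gamma_neg (Gamma_plus (Gamma_neg x) y)) y =
  Gamma_plus (Gamma_neg (Gamma_plus (Gamma_neg y) x)) x.
Proof. by apply: val_inj; rewrite !joinE lg_joinC. Qed.

HB.instance Definition _ := isMVAlgebra.Build (Gamma u)
  Gamma_plusA Gamma_plusC Gamma_plus0 Gamma_negK Gamma_plus1 Gamma_plus_join.

End GammaMV.

(** * Divisible hulls *)

(* [H] is the divisible hull of [G], seen as an l-subgroup of [H] through [d]:
   [H] is divisible and consists of the quotients [g / n]. *)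
Record divisible_hull (G H : lgroupType) (d : G -> H) : Prop := DivisibleHull {
  hullD : {morph d : x y / x + y};
  hullI : {morph d : x y / lgmeet x y};
  hullU : {morph d : x y / lgjoin x y};
  hull_inj : injective d;
  hull_div : forall (h : H) (n : nat), (0 < n)%N -> exists k : H, k *+ n = h;
  hull_frac : forall h : H, exists (g : G) (n : nat), (0 < n)%N /\ h *+ n = d g
}.

Section DivisibleHull.
Context {G H : lgroupType} {d : G -> H} (hd : divisible_hull d)
  (u : strong_unit G).

Lemma hull0 : d 0 = 0.
Proof. by apply: (addrI (d 0)); rewrite -(hullD hd) !addr0. Qed.

Lemma hull_mulrn x n : d (x *+ n) = d x *+ n.
Proof.
by elim: n => [|n IHn]; rewrite ?mulr0n ?hull0// !mulrS (hullD hd) IHn.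
Qed.

Lemma hull_le x y : x <= y -> d x <= d y.
Proof. by move=> /lg_meet_idPl xy; apply/lg_meet_idPl; rewrite -(hullI hd) xy. Qed.

Fact hull_unit_ge0 : 0 <= d (su_val u).
Proof. by rewrite -hull0 hull_le// su_ge0. Qed.

Fact hull_unit_dom (h : H) : exists n : nat, h <= d (su_val u) *+ n.
Proof.
have [g [n [n_gt0 hg]]] := hull_frac hd (lgjoin h 0).
have [m gm] := su_dom u g; exists m.
apply: (le_trans (lg_joinl h 0)).
apply: (le_trans (lg_le_mulrn (lg_joinr h 0) n_gt0)).
by rewrite hg -hull_mulrn hull_le.
Qed.

Definition hull_unit : strong_unit H := StrongUnit hull_unit_ge0 hull_unit_dom.

Fact hull_Gamma_subproof (x : Gamma u) :
  (0 <= d (val x)) && (d (val x) <= su_val hull_unit).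
Proof. by case: x => x /= /andP[x0 xu]; rewrite -hull0 !hull_le. Qed.

Definition hull_Gamma (x : Gamma u) : Gamma hull_unit :=
  exist _ (d (val x)) (hull_Gamma_subproof x).

End DivisibleHull.

(** * Dedekind-MacNeille completions *)

Definition mv_is_sup (A : mvAlgType) (S : set A) (s : A) : Prop :=
  (forall x, S x -> mvle x s) /\
  (forall t, (forall x, S x -> mvle x t) -> mvle s t).

Definition mv_complete (A : mvAlgType) : Prop :=
  forall S : set A, exists s : A, mv_is_sup S s.

Definition dedekind_macneille (B C : mvAlgType) (j : B -> C) : Prop :=
  [/\ mv_embedding j, mv_complete C &
      forall c : C, exists S : set B, mv_is_sup (j @` S) c].

(** * The Riesz MV-algebra R(A) and the canonical map A -> R(A) *)

(* R(A) is built from a presentation [phi : A -> Gamma u] of [A] as an interval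
   in an l-group [G] with strong unit, a divisible hull [d : G -> H], and a
   Dedekind-MacNeille completion [j : Gamma (hull_unit hd u) -> C] of the
   divisible hull of [A], where [C] carries its Riesz MV-algebra structure. *)
Section RA.
Context {R : realType} {A : mvAlgType} {G H : lgroupType} {u : strong_unit G}
  (phi : A -> Gamma u) {d : G -> H} (hd : divisible_hull d)
  {C : rieszMVType R} (j : Gamma (hull_unit hd u) -> C).

Definition to_completion (a : A) : C := j (hull_Gamma hd (phi a)).

Definition RA : Type := rmv_gen (range to_completion).

HB.instance Definition _ := RieszMV.on RA.

Fact iota_RA_subproof (a : A) :
  rmv_span (range to_completion) (to_completion a).
Proof. by move=> S [_]; apply; exists a. Qed.

Definition iota_RA (a : A) : RA := to_gen (iota_RA_subproof a).

End RA.

(* Main.v *)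
(** In a Riesz MV-algebra [V], every element is congruent modulo a maximal
    ideal [N] to a unique real multiple of [1], its residue.  Given embeddings
    [g : A -> B] and [f : A -> V] with [B] generated by [g(A)], call maximal
    ideals [M] of [B] and [N] of [V] compatible when they have the same trace
    on [A].  By Zorn's lemma every maximal ideal of one side is compatible with
    some maximal ideal of the other, and [g a] and [f a] have the same residue
    at compatible ideals, because MV-terms separate the reals.  Hence having
    the same residue at all compatible pairs is a relation between [B] and [V]
    preserved by the Riesz MV-operations and containing all [(g a, f a)]; it is
    defined on all of [B], and when both algebras are semisimple it is the
    graph of an embedding.  [R(A)] is semisimple because [A] is and [iota] is
    essential. *)

Require Import Defs.
From mathcomp Require Import all_boot all_order all_algebra.
From mathcomp Require Import interval_inference lra.
From mathcomp Require Import all_classical all_reals.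

Set Implicit Arguments.
Unset Strict Implicit.
Unset Printing Implicit Defensive.

Import Order.TTheory GRing.Theory Num.Theory.

Local Open Scope classical_set_scope.
Local Open Scope ring_scope.
Local Open Scope mv_scope.

Local Notation "x ⊖ y" := (x ⊙ mvneg y)
  (at level 50, left associativity) : mv_scope.

(** * Arithmetic in MV-algebras *)

Section MVTheory.
Context {A : mvAlgType}.
Implicit Types a b c t : A.

Local Notation mv1 := (mvneg (mv0 : A)).

Lemma mvminusE a b : a ⊖ b = mvneg (mvneg a ⊕ b).
Proof. by rewrite /mvtimes mvnegK. Qed.

Lemma mv0plus a : mv0 ⊕ a = a.
Proof. by rewrite mvplusC mvplus0. Qed.

Lemma mvplusACA a b c t : (a ⊕ b) ⊕ (c ⊕ t) = (a ⊕ c) ⊕ (b ⊕ t).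
Proof. by rewrite -!mvplusA (mvplusA b) (mvplusC b) (mvplusA c). Qed.

Lemma mvnegplus a : mvneg a ⊕ a = mv1.
Proof.
by have := mvplus_join a mv1; rewrite mvnegK mv0plus mvplusC mvplus1.
Qed.

Lemma mvleE a b : mvle a b <-> mvneg a ⊕ b = mv1.
Proof.
rewrite /mvle mvminusE; split=> [<-|->]; last by rewrite mvnegK.
by rewrite mvnegK.
Qed.

Lemma mvle_refl a : mvle a a.
Proof. by apply/mvleE; exact: mvnegplus. Qed.

(** The join axiom says that [(b ⊖ a) ⊕ a] is symmetric in [a] and [b]; it is their join. *)
Lemma mvminusK a b : mvle a b -> (b ⊖ a) ⊕ a = b.
Proof.
by move=> /mvleE ab; rewrite mvminusE mvplus_join ab mvnegK mv0plus.
Qed.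

Lemma mvle_anti a b : mvle a b -> mvle b a -> a = b.
Proof.
by move=> ab ba; rewrite -(mvminusK ab) ba mv0plus.
Qed.

Lemma mvle_plusl a b : mvle a (a ⊕ b).
Proof. by apply/mvleE; rewrite mvplusA mvnegplus mvplus1. Qed.

Lemma mvle_plusr a b : mvle a (b ⊕ a).
Proof. by rewrite mvplusC; exact: mvle_plusl. Qed.

Lemma mvle_trans b a c : mvle a b -> mvle b c -> mvle a c.
Proof.
move=> ab bc; rewrite -(mvminusK bc) -(mvminusK ab) mvplusA.
exact: mvle_plusr.
Qed.

Lemma mvle_plus a b c t : mvle a b -> mvle c t -> mvle (a ⊕ c) (b ⊕ t).
Proof.
move=> ab ct; rewrite -(mvminusK ab) -(mvminusK ct).
rewrite mvplusACA; exact: mvle_plusr.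
Qed.

Lemma mvle_neg a b : mvle a b -> mvle (mvneg b) (mvneg a).
Proof. by move=> /mvleE ab; apply/mvleE; rewrite mvnegK mvplusC. Qed.

Lemma mvle0 a : mvle mv0 a.
Proof. by apply/mvleE; rewrite mvplus1. Qed.

Lemma mvle1 a : mvle a mv1.
Proof. by apply/mvleE; rewrite mvplusC mvplus1. Qed.

Lemma mvle0_eq a : mvle a mv0 -> a = mv0.
Proof. by move=> a0; apply: mvle_anti => //; exact: mvle0. Qed.

Lemma mv1le_eq a : mvle mv1 a -> a = mv1.
Proof. by move=> a1; apply: mvle_anti => //; exact: mvle1. Qed.

(** Residuation: it turns inequalities about truncated differences into inequalities about sums, and
    is used so throughout. *)
Lemma mvminus_le a b c : mvle (a ⊖ b) c <-> mvle a (b ⊕ c).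
Proof. by rewrite !mvleE mvminusE mvnegK mvplusA. Qed.

Lemma mvle_minusD a b : mvle a (b ⊕ (a ⊖ b)).
Proof. by apply/mvminus_le; exact: mvle_refl. Qed.

Lemma mvle_minusl a b : mvle (a ⊖ b) a.
Proof. by apply/mvminus_le; exact: mvle_plusr. Qed.

Lemma mvle_minus a b t : mvle a b -> mvle (a ⊖ t) (b ⊖ t).
Proof. by move=> ab; apply/mvminus_le/(mvle_trans ab)/mvle_minusD. Qed.

Lemma mvminus0 a : a ⊖ mv0 = a.
Proof. by rewrite mvminusE mvplus0 mvnegK. Qed.

Lemma mvminus_trans b a c : mvle (a ⊖ c) ((a ⊖ b) ⊕ (b ⊖ c)).
Proof.
apply/mvminus_le; rewrite (mvplusC (a ⊖ b)) mvplusA.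
apply: (mvle_trans (mvle_minusD a b)); apply: mvle_plus (mvle_refl _).
exact: mvle_minusD.
Qed.

Lemma mvminus_plus a b c t :
  mvle ((a ⊕ b) ⊖ (c ⊕ t)) ((a ⊖ c) ⊕ (b ⊖ t)).
Proof.
apply/mvminus_le; rewrite mvplusACA.
by apply: mvle_plus; exact: mvle_minusD.
Qed.

Lemma mvminus_neg a b : mvneg a ⊖ mvneg b = b ⊖ a.
Proof. by rewrite !mvminusE mvnegK mvplusC. Qed.

Lemma mvminusKK a b : mvle b a -> a ⊖ (a ⊖ b) = b.
Proof.
move=> ba; rewrite mvminusE mvminusE mvplusC -[b in RHS]mvnegK; congr mvneg.
by rewrite -(mvminusK (mvle_neg ba)) mvminusE mvnegK (mvplusC b).
Qed.

Lemma mvplusK a t : mvle a (mvneg t) -> (a ⊕ t) ⊖ t = a.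
Proof.
move=> at'; rewrite -[RHS](@mvminusKK (mvneg t))//.
by rewrite !mvminusE !mvnegK mvplusC (mvplusC a).
Qed.

(* [(a ⊖ b) ∧ (b ⊖ a) = 0], phrased without the meet. *)
Lemma mvminus_disjoint a b t :
  mvle t (a ⊖ b) -> mvle t (b ⊖ a) -> t = mv0.
Proof.
(* [J] is the join of [a] and [b]. Both turn out to lie below [J ⊖ t], hence so does [J], which
   forces [t = 0]. *)
move=> tab tba; set J := (a ⊖ b) ⊕ b.
have JE : J = (b ⊖ a) ⊕ a by rewrite /J !mvminusE mvplus_join.
have tneg x y : mvle t (x ⊖ y) -> mvle y (mvneg t).
  move=> /mvle_neg; apply: mvle_trans.
  by rewrite mvminusE mvnegK; exact: mvle_plusr.
have aJ : mvle a (J ⊖ t).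
  rewrite -{1}(mvplusK (tneg _ _ tba)) JE mvplusC; apply: mvle_minus.
  exact: mvle_plus (mvle_refl _).
have bJ : mvle b (J ⊖ t).
  rewrite -{1}(mvplusK (tneg _ _ tab)) /J mvplusC; apply: mvle_minus.
  exact: mvle_plus (mvle_refl _).
have JJ : mvle J (J ⊖ t).
  rewrite -(mvminusK bJ); apply: mvle_plus (mvle_refl _).
  exact: mvle_minus.
have tJ : mvle t J.
  exact/(mvle_trans tab)/mvle_plusl.
by rewrite -(mvminusKK tJ); exact: JJ.
Qed.

Lemma mvmulnS n a : mvmuln n.+1 a = a ⊕ mvmuln n a.
Proof. by []. Qed.

Lemma mvle_muln n a b : mvle a b -> mvle (mvmuln n a) (mvmuln n b).
Proof.
by move=> ab; elim: n => [|n IHn]; [exact: mvle_refl|exact: mvle_plus].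
Qed.

Lemma mvmulnDr n a b : mvmuln n (a ⊕ b) = mvmuln n a ⊕ mvmuln n b.
Proof.
elim: n => [|n IHn]; first by rewrite /mvmuln /= mvplus0.
by rewrite !mvmulnS IHn mvplusACA.
Qed.

Lemma mvmulnDl m n a : mvmuln (m + n) a = mvmuln m a ⊕ mvmuln n a.
Proof.
elim: m => [|m IHm]; first by rewrite add0n mv0plus.
by rewrite addSn !mvmulnS IHm mvplusA.
Qed.

Lemma mvmulnM m n a : mvmuln (m * n) a = mvmuln m (mvmuln n a).
Proof.
by elim: m => [//|m IHm]; rewrite mulSn mvmulnDl IHm.
Qed.

Lemma mvle_mulnr n a : (0 < n)%N -> mvle a (mvmuln n a).
Proof. by case: n => // n _; exact: mvle_plusl. Qed.

(** Disjointness removes the copies of [b] one at a time: what remains of [a] after subtracting all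
    the rest lies below both [a] and [b]. *)
Lemma mvle_plus_muln a b c n :
  (forall t, mvle t a -> mvle t b -> t = mv0) ->
  mvle a (c ⊕ mvmuln n b) -> mvle a c.
Proof.
move=> ab; elim: n => [|n IHn]; first by rewrite mvplus0.
rewrite mvmulnS mvplusA (mvplusC c) -mvplusA mvplusC => le_a.
apply: IHn; apply: ab; first exact: mvle_minusl.
exact/mvminus_le.
Qed.

End MVTheory.

(** * Homomorphisms and embeddings of MV-algebras *)

Section MVHom.
Context {A B : mvAlgType} {f : A -> B} (hf : mv_hom f).

Lemma mv_homD a b : f (a ⊕ b) = f a ⊕ f b.
Proof. by case: hf. Qed.

Lemma mv_homN a : f (mvneg a) = mvneg (f a).
Proof. by case: hf. Qed.

Lemma mv_hom0 : f mv0 = mv0.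
Proof. by case: hf. Qed.

Lemma mv_homM a b : f (a ⊙ b) = f a ⊙ f b.
Proof. by rewrite /mvtimes mv_homN mv_homD !mv_homN. Qed.

Lemma mv_hom_le a b : mvle a b -> mvle (f a) (f b).
Proof. by rewrite /mvle => ab; rewrite -mv_homN -mv_homM ab mv_hom0. Qed.

Lemma mv_hom_muln n a : f (mvmuln n a) = mvmuln n (f a).
Proof.
by elim: n => [|n IHn]; rewrite ?mv_hom0// mvmulnS mv_homD IHn.
Qed.

End MVHom.

Lemma mv_hom_comp (A B C : mvAlgType) (f : A -> B) (g : B -> C) :
  mv_hom f -> mv_hom g -> mv_hom (g \o f).
Proof.
move=> hf hg; split=> [a b|a|] /=.
- by rewrite (mv_homD hf) (mv_homD hg).
- by rewrite (mv_homN hf) (mv_homN hg).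
- by rewrite (mv_hom0 hf) (mv_hom0 hg).
Qed.

Lemma mv_embedding_comp (A B C : mvAlgType) (f : A -> B) (g : B -> C) :
  mv_embedding f -> mv_embedding g -> mv_embedding (g \o f).
Proof.
by move=> [hf fi] [hg gi]; split; [exact: mv_hom_comp|exact: inj_comp].
Qed.

Lemma mv_embedding_le (A B : mvAlgType) (f : A -> B) (a b : A) :
  mv_embedding f -> mvle (f a) (f b) -> mvle a b.
Proof.
move=> [hf fi] ab; apply: fi.
by rewrite (mv_hom0 hf) (mv_homM hf) (mv_homN hf).
Qed.

(** * Maximal ideals *)

Section Ideals.
Context {A : mvAlgType}.
Implicit Types (I M : set A) (a b : A).

Lemma mv_ideal0 I : mv_ideal I -> I mv0.
Proof. by case=> -[a Ia] Ile _; apply: Ile Ia; exact: mvle0. Qed.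

Lemma mv_ideal_le I a b : mv_ideal I -> mvle a b -> I b -> I a.
Proof. by case=> _ Ile _; exact: Ile. Qed.

Lemma mv_idealD I a b : mv_ideal I -> I a -> I b -> I (a ⊕ b).
Proof. by case=> _ _; exact. Qed.

Lemma mv_ideal_muln I n a : mv_ideal I -> I a -> I (mvmuln n a).
Proof.
move=> hI Ia; elim: n => [|n IHn]; first exact: mv_ideal0.
exact: mv_idealD.
Qed.

Lemma mv_ideal_proper I : mv_ideal I -> I <> setT <-> ~ I (mvneg mv0).
Proof.
move=> hI; split=> [IT I1|I1 IT]; last by apply: I1; rewrite IT.
apply: IT; rewrite -subTset => a _; exact: mv_ideal_le hI (mvle1 a) I1.
Qed.

(** Maximality as an archimedean property: if [a] is outside [M], the ideal generated by [M] and [a]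
    contains 1, so [1 = m ⊕ n a] with [m] in [M], and then the negation of [n a] lies below [m]. *)
Lemma mv_maximal_idealP M :
  mv_maximal_ideal M <->
  [/\ mv_ideal M, ~ M (mvneg mv0) &
      forall a, ~ M a -> exists n, M (mvneg (mvmuln n a))].
Proof.
split=> [[hM MT Mmax]|[hM M1 March]].
  split=> //; first exact/(mv_ideal_proper hM).
  move=> a Ma; pose J := [set b | exists m n, M m /\ mvle b (m ⊕ mvmuln n a)].
  have hJ : mv_ideal J.
    split=> [|b c bc [m [n [Mm cm]]]|b c [m [n [Mm bm]]] [m' [n' [Mm' cm']]]].
    - by exists mv0, mv0, 0%N; split; [exact: mv_ideal0|exact: mvle0].
    - by exists m, n; split=> //; exact: mvle_trans cm.
    - exists (m ⊕ m'), (n + n')%N; split; first exact: mv_idealD.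
      apply: (mvle_trans (mvle_plus bm cm')).
      rewrite mvmulnDl mvplusACA; exact: mvle_refl.
  have MJ : M `<=` J.
    move=> m Mm; exists m, 0%N; split=> //.
    by rewrite mvplus0; exact: mvle_refl.
  have Ja : J a.
    exists mv0, 1%N; split; first exact: mv_ideal0.
    by rewrite mv0plus mvmulnS mvplus0; exact: mvle_refl.
  have [m [n [Mm le1]]] : J (mvneg mv0).
    apply: contrapT => J1; apply: Ma.
    by rewrite -(Mmax J hJ _ MJ)//; exact/(mv_ideal_proper hJ).
  exists n; apply: (mv_ideal_le hM _ Mm); apply/mvleE; rewrite mvnegK mvplusC.
  exact: mv1le_eq.
split=> //; first exact/(mv_ideal_proper hM).
move=> J hJ JT MJ; apply/seteqP; split=> // a Ja.
apply: contrapT => /March[n Mn]; have /(mv_ideal_proper hJ) := JT; apply.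
rewrite -(mvnegplus (mvmuln n a)); apply: mv_idealD => //; first exact: MJ.
exact: mv_ideal_muln.
Qed.

Lemma mv_maximal_ideal_exists I : mv_ideal I -> ~ I (mvneg mv0) ->
  exists M, mv_maximal_ideal M /\ I `<=` M.
Proof.
move=> hI I1.
(* Zorn is applied to the sets [J] whose union with [I] is a proper ideal, so that the empty union
   of the empty chain also qualifies. *)
pose P J := mv_ideal (I `|` J) /\ ~ (I `|` J) (mvneg mv0).
have [|J [[hJ J1] Jmax]] := @Zorn_bigcup A P.
  move=> F FP Ftot; split; last first.
    by case=> // -[X FX X1]; have [_] := FP _ FX; apply; right.
  split.
  - by exists mv0; left; exact: mv_ideal0.
  - move=> a b ab [Ib|[X FX Xb]]; first by left; exact: mv_ideal_le hI ab Ib.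
    have [hX _] := FP _ FX.
    have [Ia|Xa] := mv_ideal_le hX ab (or_intror Xb); first by left.
    by right; exists X.
  - have IX X a b : F X -> (I `|` X) a -> (I `|` X) b ->
        (I `|` \bigcup_(X in F) X) (a ⊕ b).
      move=> FX Xa Xb; have [hX _] := FP _ FX.
      by case: (mv_idealD hX Xa Xb); [left|right; exists X].
    move=> a b [Ia|[X FX Xa]] [Ib|[Y FY Yb]].
    + by left; exact: mv_idealD.
    + by apply: (IX Y) => //; [left|right].
    + by apply: (IX X) => //; [right|left].
    + have [XY|YX] := Ftot _ _ FX FY.
      * by apply: (IX Y) => //; right=> //; exact: XY.
      * by apply: (IX X) => //; right=> //; exact: YX.
exists (I `|` J); split; last by move=> a; left.
split=> //; first exact/(mv_ideal_proper hJ).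
move=> K hK KT JK; apply/seteqP; split=> //.
apply: contrapT => KJ; apply: (Jmax K).
  by split=> // [a Ja|KJ']; [apply: JK; right | apply: KJ => a /KJ' Ja; right].
have IK : I `|` K = K.
  by apply/seteqP; split=> [a [Ia|//]|a Ka]; [apply: JK; left | right].
by rewrite /P IK; split=> //; exact/(mv_ideal_proper hK).
Qed.

(** The quotient by [M] is a chain: if [a ⊖ b] is not in [M], the negation of some multiple of it
    is, and [b ⊖ a], being disjoint from [a ⊖ b], lies below that negation. *)
Lemma mv_maximal_ideal_linear M a b : mv_maximal_ideal M ->
  M (a ⊖ b) \/ M (b ⊖ a).
Proof.
move=> /mv_maximal_idealP[hM _ March].
have [|Mab] := pselect (M (a ⊖ b)); [by left | right].
have [n Mn] := March _ Mab; apply: (mv_ideal_le hM _ Mn).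
apply: (@mvle_plus_muln _ _ (a ⊖ b) _ n) => [t tb ta|].
  exact: mvminus_disjoint ta tb.
by rewrite mvnegplus; exact: mvle1.
Qed.

End Ideals.

Lemma semisimple_eq0 (A : mvAlgType) (a : A) : semisimple A ->
  (forall M : set A, mv_maximal_ideal M -> M a) -> a = mv0.
Proof. by move=> ss Ma; have : [set mv0] a by rewrite -ss => M /Ma. Qed.

(** [M] is a maximal ideal above the ideal generated by the [g a] with [f a] in [N]; injectivity of
    [g] makes that ideal proper. The trace of [M] is no larger: if [f a] is not in [N], the negation
    of some [n (f a)] is, so [M] containing [g a] would contain 1. *)
Lemma maximal_ideal_transfer (A B V : mvAlgType) (f : A -> V) (g : A -> B)
    (N : set V) : mv_hom f -> mv_embedding g -> mv_maximal_ideal N ->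
  exists M : set B, mv_maximal_ideal M /\ forall a, M (g a) <-> N (f a).
Proof.
move=> hf [hg gi] /mv_maximal_idealP[hN N1 Narch].
pose I := [set b | exists a, N (f a) /\ mvle b (g a)].
have hI : mv_ideal I.
  split=> [|b c bc [a [Na ca]]|b c [a [Na ba]] [a' [Na' ca']]].
  - exists mv0, mv0; split; last exact: mvle0.
    by rewrite (mv_hom0 hf); exact: mv_ideal0.
  - by exists a; split=> //; exact: mvle_trans ca.
  - exists (a ⊕ a'); rewrite (mv_homD hf) (mv_homD hg).
    by split; [exact: mv_idealD | exact: mvle_plus].
have I1 : ~ I (mvneg mv0).
  move=> [a [Na /mv1le_eq]]; rewrite -(mv_hom0 hg) -(mv_homN hg) => /gi a1.
  by apply: N1; rewrite -(mv_hom0 hf) -(mv_homN hf) -a1.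
have [M [Mmax IM]] := mv_maximal_ideal_exists hI I1.
have NM a : N (f a) -> M (g a).
  by move=> Na; apply: IM; exists a; split=> //; exact: mvle_refl.
exists M; split=> // a; split=> [Ma|]; last exact: NM.
apply: contrapT => /Narch[n]; rewrite -(mv_hom_muln hf) -(mv_homN hf) => /NM.
have /mv_maximal_idealP[hM M1 _] := Mmax.
move=> Mn; apply: M1; rewrite -(mvnegplus (mvmuln n (g a))).
rewrite -(mv_hom_muln hg) -(mv_homN hg).
by apply: mv_idealD => //; rewrite (mv_hom_muln hg); exact: mv_ideal_muln.
Qed.

(** Every maximal ideal of [A] is the trace of one of [B]. A nonzero [b] in all maximal ideals of
    [B] would have a multiple above some [g a] with [a > 0], and [a] would lie in all maximal ideals
    of [A]. *)
Lemma semisimple_essential (A B : mvAlgType) (g : A -> B) :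
  semisimple A -> mv_embedding g -> essential g -> semisimple B.
Proof.
move=> ss ge ess; apply/seteqP; split=> [b Mb|b -> M [hM _ _]]; last first.
  exact: mv_ideal0.
apply: contrapT => b0.
have [|a [n [[_ a0] ab]]] := ess b; first by split; [exact: mvle0|move/esym].
apply: a0; apply/esym/(semisimple_eq0 ss) => N Nmax.
have idh : mv_hom (@idfun A) by [].
have [M [Mmax MN]] := maximal_ideal_transfer idh ge Nmax.
have [hM _ _] := Mmax; apply/MN.
by apply: (mv_ideal_le hM ab); apply: mv_ideal_muln => //; exact: Mb.
Qed.

(** * Residues of a Riesz MV-algebra modulo a maximal ideal *)

Section Constants.
Context {R : realType}.
Implicit Types (r q : R).

Definition clamp01 r : R := Num.min (Num.max r 0) 1.

Lemma clamp01_ge0 r : 0 <= clamp01 r.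
Proof. by rewrite le_min ler01 le_max lexx orbT. Qed.

Lemma clamp01_le1 r : clamp01 r <= 1.
Proof. by rewrite ge_min lexx orbT. Qed.

Lemma clamp01_bounds r : 0 <= clamp01 r <= 1.
Proof. by rewrite clamp01_ge0 clamp01_le1. Qed.

Lemma clamp01_id r : 0 <= r <= 1 -> clamp01 r = r.
Proof. by case/andP=> r0 r1; rewrite /clamp01 max_l// min_l. Qed.

Lemma clamp01_le0 r : r <= 0 -> clamp01 r = 0.
Proof. by move=> r0; rewrite /clamp01 max_r// min_l. Qed.

Lemma clamp01_ge1 r : 1 <= r -> clamp01 r = 1.
Proof. by move=> r1; rewrite /clamp01 max_l ?min_r//; lra. Qed.

Variant clamp01_spec r : R -> Type :=
| ClampLe0 of r <= 0 : clamp01_spec r 0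
| ClampId of 0 <= r & r <= 1 : clamp01_spec r r
| ClampGe1 of 1 <= r : clamp01_spec r 1.

Lemma clamp01P r : clamp01_spec r (clamp01 r).
Proof.
have [r0|/ltW r0] := leP r 0; first by rewrite clamp01_le0//; constructor.
have [r1|/ltW r1] := leP r 1; first by rewrite clamp01_id ?r0//; constructor.
by rewrite clamp01_ge1//; constructor.
Qed.

Lemma clamp01_addl r q : 0 <= r -> 0 <= q ->
  clamp01 (clamp01 r + q) = clamp01 (r + q).
Proof.
move=> r0' q0; case: (clamp01P r) => [r0|//|r1]; first by congr clamp01; lra.
by rewrite !clamp01_ge1//; lra.
Qed.

(** The identity behind the recursion of [affine_term], with [r = n x - (k + 1)] and [q = x]. If
    [r >= 0] the second summand is [q]; if [r < 0] the first vanishes and the second carries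
    [r + q]. *)
Lemma clamp01_carry r q : 0 <= q <= 1 ->
  clamp01 (clamp01 r + clamp01 (q + clamp01 (r + 1) - 1)) = clamp01 (r + q).
Proof.
case/andP=> q0 q1; have [r0|r0] := leP 0 r.
  rewrite (@clamp01_ge1 (r + 1)) ?lerDr// addrK (@clamp01_id q) ?q0//.
  exact: clamp01_addl.
rewrite (clamp01_le0 (ltW r0)) add0r clamp01_id ?clamp01_bounds//.
have [r1|r1] := leP 0 (r + 1).
  by rewrite (@clamp01_id (r + 1)); [congr clamp01|]; lra.
by rewrite (clamp01_le0 (ltW r1)) !clamp01_le0//; lra.
Qed.

Definition i01_clamp r : {i01 R} := Itv01 (clamp01_ge0 r) (clamp01_le1 r).

Lemma i01_bounds (s : {i01 R}) : 0 <= s%:num <= 1.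
Proof. by rewrite ge0 le1. Qed.

Context {V : rieszMVType R}.
Implicit Types v w : V.

(* The element [r·1], with [r] truncated to the unit interval. *)
Definition cst r : V := rscale (i01_clamp r) (mvneg mv0).

Lemma cst_clamp r q : clamp01 r = clamp01 q -> cst r = cst q.
Proof. by move=> rq; congr rscale; apply/val_inj. Qed.

Lemma cst_clamp01 r : cst (clamp01 r) = cst r.
Proof. by apply: cst_clamp; rewrite clamp01_id ?clamp01_bounds. Qed.

Lemma cst_ge1 r : 1 <= r -> cst r = mvneg mv0.
Proof.
move=> r1; rewrite -[RHS](@rscale1 R); congr rscale; apply/val_inj => /=.
exact: clamp01_ge1.
Qed.

Lemma rscale_cst (s : {i01 R}) r : 0 <= r <= 1 ->
  rscale s (cst r) = cst (s%:num * r).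
Proof.
move=> r01; rewrite /cst -rscaleA; congr rscale; apply/val_inj => /=.
have /andP[r0 r1] := r01; have /andP[s0 s1] := i01_bounds s.
by rewrite !clamp01_id ?r01// mulr_ge0// mulr_ile1.
Qed.

Lemma cst_minus r q : 0 <= r <= 1 -> 0 <= q <= 1 ->
  cst r ⊖ cst q = cst (r - q).
Proof.
move=> r01 q01; rewrite /cst -rscale_max; congr rscale; apply/val_inj => /=.
rewrite (clamp01_id r01) (clamp01_id q01) /clamp01 min_l// ge_max ler01.
by rewrite andbT; lra.
Qed.

Lemma cst_le0 r : r <= 0 -> cst r = mv0.
Proof.
move=> r0; rewrite (@cst_clamp r (1 - 1)).
  by rewrite -cst_minus ?ler01 ?lexx//; exact: mvle_refl.
by rewrite subrr !clamp01_le0.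
Qed.

Lemma cst_le r q : r <= q -> mvle (cst r) (cst q).
Proof.
move=> rq; rewrite -(cst_clamp01 r) -(cst_clamp01 q) /mvle.
rewrite cst_minus ?clamp01_bounds// cst_le0//.
by case: clamp01P => ? ; case: clamp01P; lra.
Qed.

Lemma cst_neg r : 0 <= r <= 1 -> mvneg (cst r) = cst (1 - r).
Proof.
move=> r01; rewrite -cst_minus// ?ler01 ?lexx// (@cst_ge1 1)//.
by rewrite mvminusE mvnegK mv0plus.
Qed.

Lemma cst_plus r q : 0 <= r <= 1 -> 0 <= q <= 1 -> cst r ⊕ cst q = cst (r + q).
Proof.
move=> r01 q01; have r01' : 0 <= 1 - r <= 1 by lra.
(* The sum is rewritten as the negation of a difference, so that [cst_neg] and [cst_minus] apply. *)
rewrite -[LHS]mvnegK -[cst r]mvnegK -mvminusE cst_neg// cst_minus//.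
rewrite -cst_clamp01 cst_neg ?clamp01_bounds//.
apply: cst_clamp; case: (clamp01P (1 - r - q)) => *;
by do 2!case: clamp01P => *; lra.
Qed.

Lemma cst_muln r n : 0 <= r <= 1 -> mvmuln n (cst r) = cst (n%:R * r).
Proof.
move=> r01; elim: n => [|n IHn]; first by rewrite mul0r (@cst_le0 0).
rewrite mvmulnS IHn -(cst_clamp01 (n%:R * r)) cst_plus ?clamp01_bounds//.
have /andP[r0 _] := r01; apply: cst_clamp.
by rewrite addrC clamp01_addl ?mulr_ge0// -natr1 mulrDl mul1r.
Qed.

End Constants.
Arguments cst {R} V r.

(** * Congruence modulo a maximal ideal; existence of residues and their arithmetic *)

Section Residue.
Context {R : realType} {V : rieszMVType R} (N : set V)
  (hN : mv_maximal_ideal N).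
Implicit Types (r q : R) (v w : V).

Let idN : mv_ideal N. Proof. by case: hN. Qed.

Definition mv_cong v w := N (v ⊖ w) /\ N (w ⊖ v).

Lemma mv_cong_trans w v t : mv_cong v w -> mv_cong w t -> mv_cong v t.
Proof.
move=> [vw wv] [wt tw]; split.
  by apply: (mv_ideal_le idN (mvminus_trans w _ _)); exact: mv_idealD.
by apply: (mv_ideal_le idN (mvminus_trans w _ _)); exact: mv_idealD.
Qed.

Lemma mv_cong_sym v w : mv_cong v w -> mv_cong w v.
Proof. by case. Qed.

Lemma mv_cong_plus v w v' w' :
  mv_cong v v' -> mv_cong w w' -> mv_cong (v ⊕ w) (v' ⊕ w').
Proof.
move=> [vv' v'v] [ww' w'w]; split.
  by apply: (mv_ideal_le idN (mvminus_plus _ _ _ _)); exact: mv_idealD.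
by apply: (mv_ideal_le idN (mvminus_plus _ _ _ _)); exact: mv_idealD.
Qed.

Lemma mv_cong_neg v w : mv_cong v w -> mv_cong (mvneg v) (mvneg w).
Proof. by rewrite /mv_cong !mvminus_neg => -[]. Qed.

(** Both [s v ⊖ v] and [s v ⊖ s v = 0] are the multiple of [v] by the scalar 0, by [rscale_max]. *)
Lemma rscale_le (s : {i01 R}) v : mvle (rscale s v) v.
Proof.
rewrite /mvle -{2}[v](@rscale1 R) -rscale_max.
rewrite -[RHS](mvle_refl (rscale s v)) -rscale_max.
congr rscale; apply/val_inj => /=; rewrite subrr maxxx max_r//.
Qed.

Lemma mv_cong_scale (s : {i01 R}) v w :
  mv_cong v w -> mv_cong (rscale s v) (rscale s w).
Proof.
by move=> [vw wv]; split; rewrite -rscale_minus;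
  [apply: mv_ideal_le vw | apply: mv_ideal_le wv] => //; exact: rscale_le.
Qed.

(** A positive constant has a multiple equal to 1, so no proper ideal contains it. *)
Lemma ideal_cst r : r <= 1 -> N (cst V r) -> r <= 0.
Proof.
move=> r1 Nr; rewrite leNgt; apply/negP => r0.
have /mv_maximal_idealP[_ N1 _] := hN; apply: N1.
have [n nr] : exists n : nat, 1 <= n%:R * r.
  exists (Num.truncn r^-1).+1; rewrite -ler_pdivrMr// div1r ltW//.
  exact: truncnS_gt.
rewrite -(cst_ge1 (V := V) nr) -cst_muln; last by rewrite (ltW r0).
exact: mv_ideal_muln.
Qed.

(** The quotient by [N] has no infinitesimals. Otherwise the negation of some [n v] is in [N]; for
    small [e] the constant [1 - n e] lies below the sum of that negation and [n (v ⊖ e)], so it is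
    in [N] although it is positive. *)
Lemma mv_maximal_ideal_arch v :
  (forall e : R, 0 < e <= 1 -> N (v ⊖ cst V e)) -> N v.
Proof.
move=> Nv; apply: contrapT => vN.
have /mv_maximal_idealP[_ N1 March] := hN.
have [n Nn] := March _ vN.
have n0 : (0 < n.+1%:R :> R) by rewrite ltr0n.
(* Chosen so that [n e <= 1/2]; the successor keeps the denominator nonzero when [n = 0]. *)
pose e : R := (n.+1%:R *+ 2)^-1.
have e0 : 0 < e by rewrite invr_gt0 pmulrn_lgt0.
have e1 : e <= 1.
  by rewrite invf_le1 ?pmulrn_lgt0// mulr2n -natrD ler1n.
have ne : n%:R * e <= 2^-1.
  rewrite ler_pdivrMr ?pmulrn_lgt0// -[n.+1%:R *+ 2]mulr_natl mulrA mulVf//.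
  by rewrite mul1r ler_nat.
have e01 : 0 <= e <= 1 by rewrite ltW.
have ne0 : 0 <= n%:R * e by apply: mulr_ge0 => //; exact: ltW.
suff : N (cst V (1 - n%:R * e)).
  by move=> /ideal_cst; lra.
rewrite -cst_neg ?ne0 ?(le_trans ne)//; last by lra.
rewrite -cst_muln//.
have le1 : mvle (mvneg (mvmuln n (cst V e)))
    (mvneg (mvmuln n v) ⊕ mvmuln n (v ⊖ cst V e)).
  rewrite -[mvneg (mvmuln n (cst V e))]mvnegK.
  apply/mvleE; rewrite !mvnegK mvplusA (mvplusC _ (mvneg _)) -mvplusA -mvmulnDr.
  by apply/mvleE/mvle_muln/mvle_minusD.
apply: (mv_ideal_le idN le1); apply: mv_idealD => //.
by apply: mv_ideal_muln => //; apply: Nv; rewrite e0.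
Qed.

Definition residue v r := 0 <= r <= 1 /\ mv_cong v (cst V r).

Lemma residue_exists v : exists r, residue v r.
Proof.
(* The residue is the supremum of the constants that lie below [v] modulo [N]. *)
pose E := [set q : R | 0 <= q <= 1 /\ N (cst V q ⊖ v)].
have E0 : E 0.
  split; rewrite ?lexx ?ler01// cst_le0//.
  exact: mv_ideal_le (mvle_minusl _ _) (mv_ideal0 idN).
have E1 : ubound E 1 by move=> q [/andP[]].
have supE : has_sup E by split; [exists 0 | exists 1].
have r01 : 0 <= sup E <= 1.
  by rewrite (ub_le_sup _ E0) ?ge_sup//; [exists 0 | exists 1].
exists (sup E); split => //; split.
  apply: mv_maximal_ideal_arch => e /andP[e0 e1].
  have [re1|re1] := leP (sup E + e) 1; last first.
    apply: (mv_ideal_le idN _ (mv_ideal0 idN)).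
    apply/mvminus_le/mvminus_le; rewrite mvplus0 cst_plus// ?(ltW e0)//.
    by rewrite cst_ge1 ?(ltW re1)//; exact: mvle1.
  (* By linearity of the quotient, failure would put [sup E + e] into [E]. *)
  have NvE : N (v ⊖ cst V (sup E + e)).
    have [//|Nv] := mv_maximal_ideal_linear v (cst V (sup E + e)) hN.
    have : E (sup E + e) by split=> //; lra.
    by move=> /(ub_le_sup (proj2 supE)); lra.
  apply: (mv_ideal_le idN _ NvE); apply/mvminus_le/mvminus_le.
  rewrite mvplusA cst_plus ?(ltW e0)//; exact: mvle_minusD.
apply: mv_maximal_ideal_arch => e /andP[e0 e1].
have [q [q01 Nq] qe] := sup_adherent e0 supE.
apply: (mv_ideal_le idN _ Nq); apply/mvminus_le/mvminus_le.
rewrite mvplusA (mvplusC v) -mvplusA.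
apply: (mvle_trans _ (mvle_plus (mvle_refl _) (mvle_minusD (cst V q) v))).
by rewrite cst_plus ?(ltW e0)//; apply: cst_le; lra.
Qed.


Lemma residue_plus v w r q :
  residue v r -> residue w q -> residue (v ⊕ w) (clamp01 (r + q)).
Proof.
move=> [r01 vr] [q01 wq]; split; first exact: clamp01_bounds.
by rewrite cst_clamp01 -cst_plus//; exact: mv_cong_plus.
Qed.

Lemma residue_neg v r : residue v r -> residue (mvneg v) (1 - r).
Proof.
move=> [r01 vr]; split; first by lra.
by rewrite -cst_neg//; exact: mv_cong_neg.
Qed.

Lemma residue_times v w r q :
  residue v r -> residue w q -> residue (v ⊙ w) (clamp01 (r + q - 1)).
Proof.
move=> vr wq.
have := residue_neg (residue_plus (residue_neg vr) (residue_neg wq)).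
congr residue; move: vr wq => [r01 _] [q01 _].
by do 2!case: clamp01P => *; lra.
Qed.

Lemma residue_scale (s : {i01 R}) v r :
  residue v r -> residue (rscale s v) (s%:num * r).
Proof.
move=> [r01 vr]; split; last by rewrite -rscale_cst//; exact: mv_cong_scale.
have /andP[r0 r1] := r01; have /andP[s0 s1] := i01_bounds s.
by rewrite mulr_ge0// mulr_ile1.
Qed.

Lemma residue_0 : residue mv0 0.
Proof.
split; rewrite ?lexx ?ler01// cst_le0//.
by split; rewrite (mvle_refl _); exact: mv_ideal0.
Qed.

Lemma residue_ideal v r : residue v r -> N v <-> r = 0.
Proof.
move=> [/andP[r0 r1] [vr rv]]; split=> [Nv|r00].
  apply/eqP; rewrite eq_le r0 andbT; apply: ideal_cst => //.
  by apply: (mv_ideal_le idN (mvle_minusD _ v)); exact: mv_idealD.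
by move: vr; rewrite r00 cst_le0// mvminus0.
Qed.

Lemma residue_eq v w r : residue v r -> residue w r -> N (v ⊖ w).
Proof.
by move=> [_ vr] [_ wr]; have [] := mv_cong_trans vr (mv_cong_sym wr).
Qed.

End Residue.

(* If [a] has residue [r], then [affine_term n k a] has residue [n r - k],
   truncated to the unit interval. *)
Fixpoint affine_term (A : mvAlgType) (n k : nat) (a : A) : A :=
  if n is m.+1 then
    affine_term m k a ⊕ (if k is l.+1 then a ⊙ affine_term m l a else a)
  else mv0.

Lemma mv_hom_affine_term (A B : mvAlgType) (f : A -> B) n k a : mv_hom f ->
  f (affine_term n k a) = affine_term n k (f a).
Proof.
move=> hf; elim: n k => [|n IHn] [|k] /=; rewrite ?(mv_hom0 hf)//.
  by rewrite (mv_homD hf) IHn.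
by rewrite (mv_homD hf) (mv_homM hf) !IHn.
Qed.

Lemma residue_affine_term (R : realType) (V : rieszMVType R) (N : set V)
    (v : V) (r : R) n k : mv_maximal_ideal N -> residue N v r ->
  residue N (affine_term n k v) (clamp01 (n%:R * r - k%:R)).
Proof.
move=> hN vr; have [/andP[r0 r1] _] := vr; elim: n k => [|n IHn] [|k] /=.
- by rewrite mul0r subr0 clamp01_le0//; exact: residue_0.
- by rewrite mul0r sub0r clamp01_le0 ?oppr_le0//; exact: residue_0.
- have := residue_plus hN (IHn 0%N) vr; congr residue.
  by rewrite !subr0 clamp01_addl ?mulr_ge0// -natr1 mulrDl mul1r.
- have := residue_plus hN (IHn k.+1) (residue_times hN vr (IHn k)).
  congr residue; rewrite -!natr1 -[n%:R * r - k%:R](subrK 1).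
  rewrite -[n%:R * r - k%:R - 1]addrA -opprD clamp01_carry ?r0//.
  by congr clamp01; rewrite mulrDl mul1r addrAC.
Qed.

(** If [q < r], choose [n] and [k] with [n q < k < n r]. The term for [n x - k] then has residue 0
    at [N] and positive residue at [M], against the inclusion of traces. *)
Lemma residue_le (R : realType) (A : mvAlgType) (B V : rieszMVType R)
    (g : A -> B) (f : A -> V) (M : set B) (N : set V) (a : A) (r q : R) :
  mv_hom g -> mv_hom f -> mv_maximal_ideal M -> mv_maximal_ideal N ->
  (forall a, N (f a) -> M (g a)) ->
  residue M (g a) r -> residue N (f a) q -> r <= q.
Proof.
move=> hg hf hM hN NM ar aq; rewrite leNgt; apply/negP => qr.
have [/andP[q0 _] _] := aq.
(* This makes [n (r - q) > 1], which leaves room for an integer strictly between [n q] and [n r]. *)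
pose n := (Num.truncn (r - q)^-1).+1.
have nrq : 1 < n%:R * (r - q).
  by rewrite -ltr_pdivrMr ?subr_gt0// div1r; exact: truncnS_gt.
pose k := (Num.truncn (n%:R * q)).+1.
have [kl kr] : n%:R * q < k%:R /\ k%:R <= n%:R * q + 1.
  split; first exact: truncnS_gt.
  by rewrite /k -natr1 lerD2r truncn_le mulr_ge0.
have Me : M (g (affine_term n k a)).
  apply: NM; rewrite (mv_hom_affine_term _ _ _ hf).
  apply/(residue_ideal hN (residue_affine_term n k hN aq)).
  by rewrite clamp01_le0// subr_le0 ltW.
move: Me; rewrite (mv_hom_affine_term _ _ _ hg).
move/(residue_ideal hM (residue_affine_term n k hM ar)).
by case: clamp01P; lra.
Qed.

(** * The relation of having equal residues, and the extension of embeddings *)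

Section EqualResidues.
Context {R : realType} {A : mvAlgType} {B V : rieszMVType R}
  (g : A -> B) (f : A -> V).

Definition same_residues (b : B) (v : V) : Prop :=
  forall (M : set B) (N : set V), mv_maximal_ideal M -> mv_maximal_ideal N ->
    (forall a, M (g a) <-> N (f a)) ->
    exists r : R, residue M b r /\ residue N v r.

Lemma same_residues_plus b b' v v' :
  same_residues b v -> same_residues b' v' ->
  same_residues (b ⊕ b') (v ⊕ v').
Proof.
move=> bv bv' M N hM hN MN.
have [r [br vr]] := bv _ _ hM hN MN.
have [q [bq vq]] := bv' _ _ hM hN MN.
by exists (clamp01 (r + q)); split; exact: residue_plus.
Qed.

Lemma same_residues_neg b v :
  same_residues b v -> same_residues (mvneg b) (mvneg v).
Proof.
move=> bv M N hM hN MN; have [r [br vr]] := bv _ _ hM hN MN.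
by exists (1 - r); split; exact: residue_neg.
Qed.

Lemma same_residues_scale (s : {i01 R}) b v :
  same_residues b v -> same_residues (rscale s b) (rscale s v).
Proof.
move=> bv M N hM hN MN; have [r [br vr]] := bv _ _ hM hN MN.
by exists (s%:num * r); split; exact: residue_scale.
Qed.

Lemma same_residues_0 : same_residues mv0 mv0.
Proof. by move=> M N hM hN _; exists 0; split; exact: residue_0. Qed.

Lemma same_residues_hom a : mv_hom g -> mv_hom f -> same_residues (g a) (f a).
Proof.
move=> hg hf M N hM hN MN.
have [r gr] := residue_exists hM (g a).
have [q fq] := residue_exists hN (f a).
exists r; split=> //; suff -> : r = q by [].
have rq : r <= q by apply: residue_le hg hf hM hN _ gr fq => c /MN.
have qr : q <= r by apply: residue_le hf hg hN hM _ fq gr => c /MN.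
by apply/eqP; rewrite eq_le rq.
Qed.

Lemma same_residues_total b : mv_hom g -> mv_hom f ->
  rmv_span (range g) b -> exists v, same_residues b v.
Proof.
move=> hg hf /(_ [set c | exists v, same_residues c v]); apply.
split; last by move=> _ [a _ <-]; exists (f a); exact: same_residues_hom.
split=> [|c c' [v cv] [v' cv']|c [v cv]|s c [v cv]].
- by exists mv0; exact: same_residues_0.
- by exists (v ⊕ v'); exact: same_residues_plus.
- by exists (mvneg v); exact: same_residues_neg.
- by exists (rscale s v); exact: same_residues_scale.
Qed.

End EqualResidues.

Lemma same_residues_sym (R : realType) (A : mvAlgType) (B V : rieszMVType R)
    (g : A -> B) (f : A -> V) b v :
  same_residues g f b v -> same_residues f g v b.
Proof.
move=> bv N M hN hM NM; have [|r [br vr]] := bv M N hM hN; last by exists r.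
by move=> a; split=> /NM.
Qed.

(** Each maximal ideal [N] of [V] has a compatible [M] in [B]. As [b] has a single residue at [M],
    the elements [v] and [v'] are congruent modulo every [N], and semisimplicity makes them
    equal. *)
Lemma same_residues_unique (R : realType) (A : mvAlgType) (B V : rieszMVType R)
    (g : A -> B) (f : A -> V) b v v' : semisimple V ->
  mv_embedding g -> mv_hom f ->
  same_residues g f b v -> same_residues g f b v' -> v = v'.
Proof.
move=> ss hg hf.
have le w w' : same_residues g f b w -> same_residues g f b w' -> mvle w w'.
  move=> bw bw'; apply: (semisimple_eq0 ss) => N hN.
  have [M [hM MN]] := maximal_ideal_transfer hf hg hN.
  have [r [br wr]] := bw _ _ hM hN MN.
  have [q [bq wq]] := bw' _ _ hM hN MN.
  (* Comparing [M] with itself along the identity gives uniqueness of the residue of [b]. *)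
  have idB : mv_hom (@idfun B) by [].
  have rq : r = q.
    apply/eqP; rewrite eq_le (residue_le idB idB hM hM _ br bq)//.
    by rewrite (residue_le idB idB hM hM _ bq br).
  by apply: (residue_eq hN wr); rewrite rq.
by move=> bv bv'; apply: mvle_anti; exact: le.
Qed.

Lemma hom_extension (R : realType) (A : mvAlgType) (B V : rieszMVType R)
    (g : A -> B) (f : A -> V) : semisimple B -> semisimple V ->
  mv_embedding g -> rmv_span (range g) = [set: B] -> mv_embedding f ->
  exists h : B -> V, mv_embedding h /\ forall a, h (g a) = f a.
Proof.
move=> ssB ssV ge gT fe; have [hg _] := ge; have [hf _] := fe.
have [b|h hP] := @choice _ _ (same_residues g f).
  by apply: same_residues_total => //; rewrite gT.
have uniq b v : same_residues g f b v -> h b = v.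
  exact: (same_residues_unique ssV ge hf (hP b)).
exists h; split; last by move=> a; apply: uniq; exact: same_residues_hom.
split; first split=> [b c|b|].
- by apply: uniq; exact: same_residues_plus.
- by apply: uniq; exact: same_residues_neg.
- by apply: uniq; exact: same_residues_0.
(* Injectivity is uniqueness with the roles of [B] and [V] exchanged. *)
- move=> b c hbc; apply: (same_residues_unique ssB fe hg (b := h b)).
    exact/same_residues_sym/hP.
  by rewrite hbc; exact/same_residues_sym/hP.
Qed.

(** * Essential embeddings *)

Lemma essential_comp (A B C : mvAlgType) (f : A -> B) (g : B -> C) :
  mv_hom g -> essential f -> essential g -> essential (g \o f).
Proof.
move=> hg ef eg c /eg[b [n [/ef[a [m [a0 ab]]] bc]]].
exists a, (m * n)%N; split=> //; apply: (mvle_trans (mv_hom_le hg ab)).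
by rewrite (mv_hom_muln hg) mvmulnM; exact: mvle_muln.
Qed.

Lemma essential_corestrict (A B C : mvAlgType) (f : A -> B) (g : B -> C) :
  mv_embedding g -> essential (g \o f) -> essential f.
Proof.
move=> ge egf b [_ b0]; have [hg gi] := ge.
have [|a [n [a0 ab]]] := egf (g b).
  by split; [exact: mvle0|rewrite -(mv_hom0 hg) => /gi].
exists a, n; split=> //; apply: (mv_embedding_le ge).
by rewrite (mv_hom_muln hg).
Qed.

Lemma mv_isomorphism_essential (A B : mvAlgType) (f : A -> B) :
  mv_isomorphism f -> essential f.
Proof.
move=> [hf [f' fK f'K]] b [_ b0]; exists (f' b), 1%N.
rewrite f'K mvmulnS mvplus0; split; last exact: mvle_refl.
split; first exact: mvle0.
by move=> e; apply: b0; rewrite -(f'K b) -e (mv_hom0 hf).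
Qed.

(** A nonzero [c] is a supremum of images of elements of [B]; they cannot all be zero, and a nonzero
    one serves with multiple 1. *)
Lemma dedekind_macneille_essential (B C : mvAlgType) (j : B -> C) :
  dedekind_macneille j -> essential j.
Proof.
move=> [[hj ji] _ jsup] c [_ c0]; have [S [Sc cS]] := jsup c.
have [b Sb b0] : exists2 b, S b & b <> mv0.
  apply: contrapT => S0; apply: c0; apply/esym/mvle0_eq/cS => _ [b Sb <-].
  have -> : b = mv0 by apply: contrapT => b0; apply: S0; exists b.
  by rewrite (mv_hom0 hj); exact: mvle_refl.
exists b, 1%N; rewrite mvmulnS mvplus0; split; last by apply: Sc; exists b.
by split; [exact: mvle0|move/esym].
Qed.

(** * Essentiality of the embedding into the divisible hull *)

Section Gamma.
Context {G : lgroupType} {u : strong_unit G}.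
Implicit Types x : Gamma u.

Lemma Gamma_mvmuln n x :
  val (mvmuln n x) = lgmeet (val x *+ n) (su_val u).
Proof.
elim: n => [|n IHn]; first by apply/esym/lg_meet_idPl; exact: su_ge0.
have x0 : 0 <= val x by case/andP: (valP x).
rewrite mvmulnS /= IHn mulrSr [sval x + _]addrC lg_meetDr -lg_meetA.
congr lgmeet; rewrite lg_meetC; apply/lg_meet_idPl.
by rewrite -[leLHS]addr0; exact: lgD.
Qed.

End Gamma.

Section DivisibleHullGamma.
Context {G H : lgroupType} {d : G -> H} (hd : divisible_hull d)
  (u : strong_unit G).

Lemma hull_le_inv x y : d x <= d y -> x <= y.
Proof.
move=> /lg_meet_idPl; rewrite -(hullI hd) => /(hull_inj hd) <-.
exact: lg_meetr.
Qed.

Lemma hull_Gamma_embedding : mv_embedding (hull_Gamma hd (u := u)).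
Proof.
split; last by move=> x y /(congr1 val)/(hull_inj hd) xy; exact/val_inj.
split=> [x y|x|]; apply/val_inj => /=.
- by rewrite (hullI hd) (hullD hd).
- by apply: (addIr (d (val x))); rewrite -(hullD hd) !subrK.
- exact: hull0.
Qed.

Lemma hull_Gamma_essential : essential (hull_Gamma hd (u := u)).
Proof.
move=> b [_ b0]; have [g [n [n0 bg]]] := hull_frac hd (val b).
have g0 : 0 <= g.
  apply: hull_le_inv; rewrite (hull0 hd) -bg lg_mulrn_ge0//.
  by case/andP: (valP b).
have aP : (0 <= lgmeet g (su_val u)) && (lgmeet g (su_val u) <= su_val u).
  by rewrite lg_meetr lg_le_meet g0 su_ge0.
(* From [n b = d g] in [H], truncating at the unit shows that the image of the meet of [g] with [u]
   is exactly the MV-multiple [n b]. *)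
pose a : Gamma u := exist _ (lgmeet g (su_val u)) aP.
have aE : hull_Gamma hd a = mvmuln n b.
  by apply/val_inj; rewrite Gamma_mvmuln bg /= (hullI hd).
exists a, n; split; last by rewrite aE; exact: mvle_refl.
split; first exact: mvle0.
move=> a0; apply/b0/esym/mvle0_eq.
rewrite -(mv_hom0 (proj1 hull_Gamma_embedding)) a0 aE.
exact: mvle_mulnr.
Qed.

End DivisibleHullGamma.

(** * The generated Riesz MV-algebra and its generators *)

Section RieszGenerated.
Context {R : realType} {V : rieszMVType R} (X : set V).

Lemma of_gen_embedding : mv_embedding (@of_gen R V X).
Proof.
split; last exact: of_gen_inj.
by split=> [x y|x|]; [exact: of_gen_plus|exact: of_gen_neg|exact: of_gen_0].
Qed.

(** The image in [V] of a subalgebra containing the generators is a subalgebra containing [X], hence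
    contains the span; injectivity of [of_gen] brings this back. *)
Lemma rmv_span_gen :
  rmv_span [set x : rmv_gen X | X (of_gen x)] = [set: rmv_gen X].
Proof.
rewrite -subTset => x _ S [[S0 SD SN SZ] XS].
have /(_ (@of_gen R V X @` S))[|y Sy /of_gen_inj <-//] := of_genP x.
split; last first.
  move=> v Xv; have sv : rmv_span X v by move=> T [_]; exact.
  by exists (to_gen sv) => //; exact: XS.
split=> [|_ _ [y Sy <-] [z Sz <-]|_ [y Sy <-]|s _ [y Sy <-]].
- by exists mv0 => //; exact: of_gen_0.
- by exists (y ⊕ z); [exact: SD|exact: of_gen_plus].
- by exists (mvneg y); [exact: SN|exact: of_gen_neg].
- by exists (rscale s y); [exact: SZ|exact: of_gen_scale].
Qed.

End RieszGenerated.

Theorem theorem4p1 (R : realType) (A : mvAlgType) (A_ss : semisimple A)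
    (G : lgroupType) (u : strong_unit G)
    (phi : A -> Gamma u) (phi_iso : mv_isomorphism phi)
    (H : lgroupType) (d : G -> H) (hd : divisible_hull d)
    (C : rieszMVType R) (j : Gamma (hull_unit hd u) -> C)
    (j_dm : dedekind_macneille j) :
  [/\ mv_embedding (iota_RA phi j) /\
        rmv_span (range (iota_RA phi j)) = [set: RA phi j],
      essential (iota_RA phi j) &
      forall (V : rieszMVType R), semisimple V ->
        forall f : A -> V, mv_embedding f ->
          exists fR : RA phi j -> V,
            mv_embedding fR /\ forall a : A, fR (iota_RA phi j a) = f a].
Proof.
have [[hj ji] _ _] := j_dm; have [hphi /bij_inj phii] := phi_iso.
have hull_emb := hull_Gamma_embedding hd u.
(* Embedding and essentiality are proved first for the map into the completion [C], then transferred
   to [RA], which embeds in [C] by [of_gen]. *)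
pose T := to_completion phi (hd := hd) j.
have T_emb : mv_embedding T.
  apply: (mv_embedding_comp (g := j)) (conj hj ji).
  exact: mv_embedding_comp (conj hphi phii) hull_emb.
have T_ess : essential T.
  have A_d_ess := essential_comp (proj1 hull_emb)
    (mv_isomorphism_essential phi_iso) (@hull_Gamma_essential _ _ _ hd u).
  exact: essential_comp hj A_d_ess (dedekind_macneille_essential j_dm).
have gen_emb := of_gen_embedding (range T).
have iota_emb : mv_embedding (iota_RA phi j).
  have [[TD TN T0] Ti] := T_emb; split; last first.
    by move=> a b /(congr1 (@of_gen R C (range T)))/Ti.
  split=> [a b|a|]; apply: of_gen_inj.
  - by rewrite of_gen_plus; exact: TD.
  - by rewrite of_gen_neg; exact: TN.
  - by rewrite of_gen_0; exact: T0.
have iota_span : rmv_span (range (iota_RA phi j)) = [set: RA phi j].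
  rewrite -[RHS](@rmv_span_gen R C (range T)); congr rmv_span.
  apply/seteqP; split=> [_ [a _ <-]|x [a _ ax]]; first by exists a.
  by exists a => //; exact: of_gen_inj.
have iota_ess : essential (iota_RA phi j).
  exact: (@essential_corestrict A _ C (iota_RA phi j) _ gen_emb T_ess).
split=> // V V_ss f f_emb.
exact: hom_extension (semisimple_essential A_ss iota_emb iota_ess) V_ss
  iota_emb iota_span f_emb.
Qed.
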